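(* Let $E,A\in\mathbb{R}^{n\times n}$ and $C\in\mathbb{R}^{m\times n}$, with $E$ singular and the pencil $sE-A$ regular, and let $r\in\{0,1,\ldots,n-1\}$. The system $E\dot x(t)=Ax(t),\ y(t)=Cx(t)$ has no unobservable impulse of order $\le r$ if and only if $$\operatorname{rank}(\mathcal{O}_{r+2}(E,A,C))=n(r+1)+\operatorname{rank}(E).$$
   Context: The pencil $sE-A$ is regular if $\det(sE-A)$ is not the zero polynomial in $s$. $\mathbb{R}^n[s]$ denotes the set of $n$-dimensional vectors of real polynomials in $s$; the degree of a nonzero $P(s)=\sum_{i=0}^p s^iv_i$ with $v_i\in\mathbb{R}^n$, $v_p\ne0$, is $\deg(P(s))=p$. Definition (unobservable impulse): let $(v,P(s))\in\mathbb{R}^n\times\mathbb{R}^n[s]$ with $P(s)$ nonzero and $\deg(P(s))=q$ satisfy $$\begin{bmatrix} sE-A\\ C\end{bmatrix}P(s)=\begin{bmatrix}Ev\\0\end{bmatrix}.$$ Then $P(s)$ is called an unobservable impulse of order $q$ of the system $E\dot x=Ax,\ y=Cx$. For an integer $k\ge 2$, $\mathcal{O}_k(E,A,C)$ is the real $(kn+(k-1)m)\times kn$ matrix partitioned into $k$ block columns (each of width $n$) and $2k-1$ block rows as follows. The first $k$ block rows (each of height $n$) form the block upper bidiagonal matrix with $E$ in each diagonal block $(i,i)$, $1\le i\le k$, and $A$ in each superdiagonal block $(i,i+1)$, $1\le i\le k-1$. The remaining $k-1$ block rows (each of height $m$) have, in the $j$-th of them ($1\le j\le k-1$), the block $C$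 in block column $j+1$. All other blocks are zero. *)

(* Defs.v *)
From HB Require Import structures.
From mathcomp Require Import all_boot all_order all_algebra.
From mathcomp Require Import reals.

Set Implicit Arguments.
Unset Strict Implicit.
Unset Printing Implicit Defensive.

Import GRing.Theory.
Local Open Scope ring_scope.

(* R^{m x n} seen inside R^{m x n}[s]; the indeterminate s is 'X. *)
Definition const_pmx (R : fieldType) (m n : nat) (M : 'M[R]_(m, n)) :
    'M[{poly R}]_(m, n) := map_mx polyC M.

Definition pencil (R : fieldType) (n : nat) (E A : 'M[R]_n) :
    'M[{poly R}]_n := 'X *: const_pmx E - const_pmx A.

Definition regular_pencil (R : fieldType) (n : nat) (E A : 'M[R]_n) : Prop :=
  \det (pencil E A) != 0.

Definition pvec_degree (R : fieldType) (n : nat) (P : 'cV[{poly R}]_n)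
    (p : nat) : Prop :=
  exists v : 'I_p.+1 -> 'cV[R]_n,
    P = \sum_(i < p.+1) 'X^i *: const_pmx (v i) /\ v ord_max != 0.

Definition unobservable_impulse (R : fieldType) (n m : nat)
    (E A : 'M[R]_n) (C : 'M[R]_(m, n)) (P : 'cV[{poly R}]_n) (q : nat) : Prop :=
  exists v : 'cV[R]_n,
    [/\ P != 0, pvec_degree P q &
        col_mx (pencil E A) (const_pmx C) *m P
        = col_mx (const_pmx (E *m v)) 0].

(* Block indices start at 0, so block row j of the C-part, whose only nonzero
   block is in column j + 1, is the (j + 1)-st one in 1-based numbering. The
   sizes \sum_(i < k) n and \sum_(i < k.-1) m are those produced by \mxblock;
   they equal k * n and (k - 1) * m. Meaningful for 2 <= k. *)
Definition obs_mx (R : fieldType) (n m : nat) (k : nat)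
    (E A : 'M[R]_n) (C : 'M[R]_(m, n)) :
    'M[R]_(\sum_(i < k) n + \sum_(i < k.-1) m, \sum_(i < k) n) :=
  col_mx
    (\mxblock_(i < k, j < k)
       (if j == i :> nat then E else if j == i.+1 :> nat then A else 0))
    (\mxblock_(i < k.-1, j < k) (if j == i.+1 :> nat then C else 0)).

(* Main.v *)
(* Put [x_0 = v] and [x_(i+1) = (-1)^i p_i], where [p_i] are the coefficients
   of [P].  Comparing coefficients, [P] is an unobservable impulse of order at
   most [r] exactly when [x] has [E x_i + A x_(i+1) = 0] and [C x_(i+1) = 0]
   for all [i], vanishes from index [r + 2] on, and has some nonzero term past
   [x_0]; such sequences are the kernel vectors of [obs_mx r.+2 E A C].  That
   kernel always contains the vectors [(x_0, 0, ..., 0)] with [E x_0 = 0], which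
   form a space of dimension [n - \rank E], and it is no larger exactly when
   there is no unobservable impulse. *)
Require Import Defs.
From HB Require Import structures.
From mathcomp Require Import all_boot all_order all_algebra.
From mathcomp Require Import reals.
From mathcomp Require Import zify.

Set Implicit Arguments.
Unset Strict Implicit.
Unset Printing Implicit Defensive.

Import GRing.Theory.
Local Open Scope ring_scope.

Definition impulse_chain (R : fieldType) (n m l : nat) (E A : 'M[R]_n)
    (C : 'M[R]_(m, n)) (x : nat -> 'M[R]_(n, l)) : Prop :=
  (forall i, E *m x i + A *m x i.+1 = 0) /\ (forall i, C *m x i.+1 = 0).

Lemma sum_mulmx_at (R : fieldType) (m n l k p : nat) (M : 'M[R]_(m, n))
    (x : nat -> 'M[R]_(n, l)) :
  (forall i, (k <= i)%N -> x i = 0) ->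
  \sum_(j < k) (if j == p :> nat then M else 0) *m x j = M *m x p.
Proof.
move=> x0; have [pk|kp] := ltnP p k.
  rewrite (bigD1 (Ordinal pk)) //= eqxx big1 ?addr0 // => j.
  by rewrite -val_eqE /= => /negPf->; rewrite mul0mx.
rewrite x0 // mulmx0 big1 // => j _.
by rewrite ltn_eqF ?mul0mx // (leq_trans (ltn_ord j)).
Qed.

Lemma obs_mx_mulmx_eq0 (R : fieldType) (n m l k : nat) (E A : 'M[R]_n)
    (C : 'M[R]_(m, n)) (x : nat -> 'M[R]_(n, l)) :
  (forall i, (k <= i)%N -> x i = 0) ->
  obs_mx k E A C *m \mxcol_(i < k) x i = 0 <-> impulse_chain E A C x.
Proof.
move=> x0.
have -> : obs_mx k E A C *m \mxcol_(i < k) x i =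
    col_mx (\mxcol_(i < k) (E *m x i + A *m x i.+1))
           (\mxcol_(i < k.-1) (C *m x i.+1)).
  rewrite mul_col_mx !mxblockEv !mxcol_mul; congr col_mx; apply/eq_mxcolP => i.
    rewrite mul_mxrow_mxcol -(sum_mulmx_at i E x0) -(sum_mulmx_at i.+1 A x0).
    rewrite -big_split; apply: eq_bigr => j _ /=; rewrite -mulmxDl.
    have [->|_] := eqVneq (j : nat) i; last by rewrite add0r.
    by rewrite (ltn_eqF (ltnSn i)) addr0.
  by rewrite mul_mxrow_mxcol (sum_mulmx_at i.+1 C x0).
split=> [/eqP|[EAx Cx]]; last first.
  apply/eqP; rewrite col_mx_eq0; apply/andP.
  by split; apply/eqP; rewrite -[RHS]mxcol0; apply/eq_mxcolP.
rewrite col_mx_eq0 => /andP[/eqP/esym + /eqP/esym].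
rewrite -!mxcol0 => /eq_mxcolP EAx /eq_mxcolP Cx; split=> i.
  have [ik|ki] := ltnP i k; first by rewrite -(EAx (Ordinal ik)).
  by rewrite !x0 ?mulmx0 ?addr0 // ltnW.
have [ik|ki] := ltnP i k.-1; first by rewrite -(Cx (Ordinal ik)).
by rewrite x0 ?mulmx0 //; lia.
Qed.

Definition block_seq (R : fieldType) (n l k : nat)
    (u : 'M[R]_(\sum_(i < k) n, l)) (j : nat) : 'M[R]_(n, l) :=
  if insub j is Some i then submxcol u i else 0.

Lemma block_seqK (R : fieldType) (n l k : nat)
    (u : 'M[R]_(\sum_(i < k) n, l)) :
  \mxcol_(i < k) block_seq u i = u.
Proof.
by rewrite -[RHS]submxcolK; apply/eq_mxcolP => i; rewrite /block_seq valK.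
Qed.

Lemma block_seq_default (R : fieldType) (n l k : nat)
    (u : 'M[R]_(\sum_(i < k) n, l)) (j : nat) :
  (k <= j)%N -> block_seq u j = 0.
Proof. by move=> kj; rewrite /block_seq insubF // ltnNge kj. Qed.

Lemma rank_obs_mxP (R : fieldType) (n m p : nat) (E A : 'M[R]_n)
    (C : 'M[R]_(m, n)) :
  \rank (obs_mx p.+1 E A C) = (n * p + \rank E)%N <->
  (forall x : nat -> 'cV[R]_n,
     impulse_chain E A C x -> (forall i, (p < i)%N -> x i = 0) ->
     forall i, x i.+1 = 0).
Proof.
set O := obs_mx _ _ _ _.
pose x0 l (w : 'M[R]_(n, l)) (j : nat) : 'M[R]_(n, l) :=
  if j == 0%N then w else 0.
pose J : 'M_(n, \sum_(i < p.+1) n) := \mxrow_(j < p.+1) (x0 n 1%:M j)^T.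
have JE l (w : 'M_(n, l)) : (w^T *m J)^T = \mxcol_(j < p.+1) x0 l w j.
  rewrite mul_mxrow tr_mxrow; apply/eq_mxcolP => i; rewrite /x0 /=.
  by case: eqP; rewrite ?trmx1 ?trmx0 ?mulmx1 ?mulmx0 ?trmxK ?trmx0.
have Jfree : row_free J.
  apply/row_freeP; exists (\mxcol_(j < p.+1) x0 n 1%:M j).
  rewrite mul_mxrow_mxcol big_ord_recl big1 => [|i _].
    by rewrite /x0 trmx1 mulmx1 addr0.
  by rewrite /x0 mulmx0.
pose U := kermx E^T *m J; pose S := kermx O^T.
have sUS : (U <= S)%MS.
  rewrite /U; apply/sub_kermxP/trmx_inj; rewrite trmx_mul trmxK trmx0 -[kermx E^T]trmxK JE.
  apply/obs_mx_mulmx_eq0; first by case.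
  split=> i; rewrite /x0 /= mulmx0 // addr0; case: eqP; rewrite ?mulmx0 // => _.
  by apply: trmx_inj; rewrite trmx_mul trmxK mulmx_ker trmx0.
have rU : \rank U = (n - \rank E)%N by rewrite mxrankMfree // mxrank_ker mxrank_tr.
have rS : \rank S = (n * p.+1 - \rank O)%N.
  by rewrite mxrank_ker mxrank_tr; congr subn; rewrite sum_nat_const card_ord mulnC.
have rO : (\rank O <= n * p.+1)%N.
  apply: leq_trans (rank_leq_col O) _.
  by rewrite sum_nat_const card_ord mulnC.
have -> : \rank O = (n * p + \rank E)%N <-> (S <= U)%MS.
  rewrite -[(S <= U)%MS](mxrank_leqif_sup sUS).2 rU rS.
  move: (\rank O) rO (rank_leq_row E) => rkO rO rE.
  by rewrite mulnS in rO *; split=> [?|/eqP]; [apply/eqP|]; lia.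
split=> [sSU x chx xp|Hx].
  have : ((\mxcol_(i < p.+1) x i)^T <= U)%MS.
    apply: submx_trans sSU; apply/sub_kermxP.
    by rewrite -trmx_mul (obs_mx_mulmx_eq0 E A C xp).2 // trmx0.
  case/submxP=> D; rewrite mulmxA => /(congr1 trmx); rewrite trmxK.
  rewrite -{1}[D *m _]trmxK JE => /eq_mxcolP xE i.
  have [ip|pi] := ltnP i p; last exact: xp.
  by rewrite (xE (Ordinal (ip : (i.+1 < p.+1)%N))).
apply/rV_subP => v /sub_kermxP vO; have := @block_seqK R n 1 p.+1 v^T.
set x := block_seq _ => xE.
have xp i : (p < i)%N -> x i = 0 by exact: block_seq_default.
have chx : impulse_chain E A C x.
  apply/(obs_mx_mulmx_eq0 E A C xp).
  by rewrite xE -[_ *m _]trmxK trmx_mul trmxK vO trmx0.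
suff -> : v = (x 0%N)^T *m J.
  rewrite submxMr //; apply/sub_kermxP; rewrite -trmx_mul.
  by have := chx.1 0%N; rewrite Hx // mulmx0 addr0 => ->; rewrite trmx0.
apply: trmx_inj; rewrite JE -xE; apply/eq_mxcolP => -[[|i] ip] //=.
by rewrite /x0 Hx.
Qed.

Definition coef_mx (R : fieldType) (n l : nat) (P : 'M[{poly R}]_(n, l))
    (i : nat) : 'M[R]_(n, l) := map_mx (coefp i) P.

Lemma coef_mxP (R : fieldType) (n l : nat) (P Q : 'M[{poly R}]_(n, l)) :
  P = Q <-> forall i, coef_mx P i = coef_mx Q i.
Proof.
split=> [-> //|PQ]; apply/matrixP => a b; apply/polyP => i.
by have /matrixP/(_ a b) := PQ i; rewrite !mxE.
Qed.

Lemma coef_mx0 (R : fieldType) (n l i : nat) :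
  coef_mx (0 : 'M[{poly R}]_(n, l)) i = 0.
Proof. exact: map_mx0. Qed.

Lemma coef_const_pmx (R : fieldType) (n l i : nat) (M : 'M[R]_(n, l)) :
  coef_mx (const_pmx M) i = if i == 0%N then M else 0.
Proof. by apply/matrixP=> a b; rewrite !mxE /= coefC; case: (i == 0)%N; rewrite ?mxE. Qed.

Lemma coef_const_pmxM (R : fieldType) (m n l i : nat) (M : 'M[R]_(m, n))
    (P : 'M[{poly R}]_(n, l)) :
  coef_mx (const_pmx M *m P) i = M *m coef_mx P i.
Proof.
apply/matrixP=> a b; rewrite !mxE /= coef_sum; apply: eq_bigr => j _.
by rewrite !mxE coefCM.
Qed.

Lemma coef_scaleX (R : fieldType) (n l i : nat) (P : 'M[{poly R}]_(n, l)) :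
  coef_mx ('X *: P) i = if i is j.+1 then coef_mx P j else 0.
Proof.
by apply/matrixP => a b; rewrite !mxE /= coefXM; case: i => [|i]; rewrite !mxE.
Qed.

Lemma coef_pencilM (R : fieldType) (n l i : nat) (E A : 'M[R]_n)
    (P : 'M[{poly R}]_(n, l)) :
  coef_mx (pencil E A *m P) i =
  E *m (if i is j.+1 then coef_mx P j else 0) - A *m coef_mx P i.
Proof.
rewrite mulmxBl /coef_mx map_mxB -!/(coef_mx _ _) coef_const_pmxM; congr (_ - _).
by rewrite -scalemxAl coef_scaleX; case: i => [|i]; rewrite ?mulmx0 ?coef_const_pmxM.
Qed.

Lemma coef_sum_Xn_pmx (R : fieldType) (n l p i : nat)
    (x : nat -> 'M[R]_(n, l)) :
  coef_mx (\sum_(j < p) 'X^j *: const_pmx (x j)) i =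
  if (i < p)%N then x i else 0.
Proof.
apply/matrixP=> a b; rewrite mxE summxE /= coef_sum.
under eq_bigr do rewrite !mxE coefMC coefXn.
case: ltnP => [ip|pi].
  rewrite (bigD1 (Ordinal ip)) //= eqxx mul1r big1 ?addr0 // => j.
  by rewrite -val_eqE /= eq_sym => /negPf->; rewrite mul0r.
rewrite mxE big1 // => j _.
by rewrite gtn_eqF ?mul0r // (leq_trans (ltn_ord j)).
Qed.

Lemma pvec_degree_coef (R : fieldType) (n q : nat) (P : 'cV[{poly R}]_n) :
  pvec_degree P q -> forall i, (q < i)%N -> coef_mx P i = 0.
Proof.
move=> [v [-> _]] i qi; pose x j := v (inord j).
have -> : \sum_(j < q.+1) 'X^j *: const_pmx (v j) =
          \sum_(j < q.+1) 'X^j *: const_pmx (x j).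
  by apply: eq_bigr => j _; rewrite /x inord_val.
by rewrite coef_sum_Xn_pmx ltnNge qi.
Qed.

Lemma pvec_degree_exists (R : fieldType) (n r : nat) (P : 'cV[{poly R}]_n) :
  P != 0 -> (forall i, (r < i)%N -> coef_mx P i = 0) ->
  exists2 q, (q <= r)%N & pvec_degree P q.
Proof.
move=> P0 Pr.
have exP : exists i, coef_mx P i != 0.
  have /existsP[i ci] : [exists i : 'I_r.+1, coef_mx P i != 0].
    apply: contraNT P0; rewrite negb_exists => /forallP c0; apply/eqP/coef_mxP => i.
    rewrite coef_mx0; have [/Pr //|ir] := ltnP r i.
    by have /negPn/eqP := c0 (Ordinal (ir : (i < r.+1)%N)).
  by exists i.
have ubP i : coef_mx P i != 0 -> (i <= r)%N.
  by rewrite leqNgt; apply: contraNN => /Pr->.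
case: (ex_maxnP exP ubP) => q cq maxq; exists q; first exact: ubP.
exists (fun i => coef_mx P i); split=> //; apply/coef_mxP => i.
rewrite coef_sum_Xn_pmx; case: ltnP => // qi; apply/eqP.
by apply: contraTT qi => /maxq; rewrite -leqNgt.
Qed.

Definition impulse_seq (R : fieldType) (n : nat) (v : 'cV[R]_n)
    (P : 'cV[{poly R}]_n) (i : nat) : 'cV[R]_n :=
  if i is j.+1 then (-1) ^+ j *: coef_mx P j else v.

Lemma impulse_eqP (R : fieldType) (n m : nat) (E A : 'M[R]_n)
    (C : 'M[R]_(m, n)) (v : 'cV[R]_n) (P : 'cV[{poly R}]_n) :
  col_mx (pencil E A) (const_pmx C) *m P = col_mx (const_pmx (E *m v)) 0 <->
  impulse_chain E A C (impulse_seq v P).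
Proof.
have stepE i : E *m impulse_seq v P i.+1 + A *m impulse_seq v P i.+2 =
    (-1) ^+ i *: (E *m coef_mx P i - A *m coef_mx P i.+1).
  by rewrite /= -!scalemxAr exprS mulN1r scaleNr scalerBr.
have signK l (M N : 'M[R]_(l, 1)) i : (-1) ^+ i *: M = 0 -> M = 0.
  by move/eqP; rewrite scaler_eq0 signr_eq0 => /eqP.
rewrite mul_col_mx; split=> [/eq_col_mx[/coef_mxP EA /coef_mxP CP]|[EA CP]].
  split=> [[|i]|i]; last 1 first.
  - by rewrite /= -scalemxAr -coef_const_pmxM CP coef_mx0 scaler0.
  - have := EA 0%N; rewrite coef_pencilM coef_const_pmx /= mulmx0 sub0r => <-.
    by rewrite scale1r addNr.
  - by have := EA i.+1; rewrite stepE coef_pencilM coef_const_pmx /= => ->; rewrite scaler0.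
congr col_mx; apply/coef_mxP => i; last first.
  by rewrite coef_const_pmxM coef_mx0; apply: (signK _ _ 0 i); rewrite scalemxAr CP.
rewrite coef_pencilM coef_const_pmx; case: i => [|i] /=.
  rewrite mulmx0 sub0r; apply/eqP; rewrite eq_sym -addr_eq0.
  by have := EA 0%N; rewrite /= scale1r => ->.
by apply: (signK _ _ 0 i); rewrite -stepE EA.
Qed.

Lemma unobservable_impulse_chainP (R : fieldType) (n m r : nat)
    (E A : 'M[R]_n) (C : 'M[R]_(m, n)) :
  (exists (P : 'cV[{poly R}]_n) (q : nat),
     (q <= r)%N /\ unobservable_impulse E A C P q) <->
  (exists x : nat -> 'cV[R]_n,
     [/\ impulse_chain E A C x, forall i, (r.+1 < i)%N -> x i = 0
       & exists i, x i.+1 != 0]).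
Proof.
split=> [[P [q [qr [v [P0 Pq /impulse_eqP chP]]]]]|[x [chx xr [i0 xi0]]]].
  exists (impulse_seq v P); split=> // [[//|i] ri|].
    by rewrite /= (pvec_degree_coef Pq) ?scaler0 // (leq_ltn_trans qr).
  have [v' [PE vq]] := Pq; exists q; rewrite scaler_eq0 signr_eq0 /=.
  pose y j := v' (inord j).
  have -> : P = \sum_(j < q.+1) 'X^j *: const_pmx (y j).
    by rewrite PE; apply: eq_bigr => j _; rewrite /y inord_val.
  by rewrite coef_sum_Xn_pmx ltnSn /y -[q in inord q]/(val (@ord_max q)) inord_val.
pose P := \sum_(j < r.+1) 'X^j *: const_pmx ((-1) ^+ j *: x j.+1).
have cP i : coef_mx P i = (-1) ^+ i *: x i.+1.
  rewrite (coef_sum_Xn_pmx _ _ (fun j => (-1) ^+ j *: x j.+1)).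
  by case: ltnP => // ri; rewrite xr ?scaler0.
have seqE i : impulse_seq (x 0%N) P i = x i.
  by case: i => //= i; rewrite cP scalerA -expr2 sqrr_sign scale1r.
have P0 : P != 0.
  apply: contraNneq xi0 => P0; have := cP i0; rewrite P0 coef_mx0 => /esym/eqP.
  by rewrite scaler_eq0 signr_eq0.
have [|q qr Pq] := @pvec_degree_exists R n r P P0.
  by move=> i ri; rewrite cP xr ?scaler0.
exists P, q; split=> //; exists (x 0%N); split=> //; apply/impulse_eqP.
by split=> i; rewrite !seqE; [apply: chx.1 | apply: chx.2].
Qed.

Theorem theorem2p3 (R : realType) (n m : nat) (E A : 'M[R]_n)
    (C : 'M[R]_(m, n)) (r : nat)
    (E_singular : E \notin unitmx)
    (EA_regular : regular_pencil E A)
    (r_lt_n : (r < n)%N) :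
  ~ (exists (P : 'cV[{poly R}]_n) (q : nat),
       (q <= r)%N /\ unobservable_impulse E A C P q)
  <->
  \rank (obs_mx r.+2 E A C) = (n * r.+1 + \rank E)%N.
Proof.
rewrite rank_obs_mxP unobservable_impulse_chainP.
split=> [noimp x chx xr i|x0 [x [chx xr [i]]]]; last by rewrite (x0 x) // eqxx.
by apply/eqP; apply: contra_notT noimp => xi; exists x; split=> //; exists i.
Qed.
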